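(* No square-free odd positive integer is a strong or a weak alpha number of order $(1,1)$.
   Context: For a positive integer $n$, $\sigma(n)=\sum_{d\mid n} d$; $\omega(n)$ is the number of distinct prime divisors of $n$; $\tau(n)$ is the number of positive divisors of $n$. A positive integer $n$ is a strong alpha number of order $(1,1)$ if there exist coprime positive integers $\alpha_1,\alpha_2$ with $\sigma(n)=\frac{\alpha_1}{\alpha_2}n$ and $2\le \max(\alpha_1,\alpha_2)\le \omega(n)$; it is a weak alpha number of order $(1,1)$ if there exist coprime positive integers $\alpha_1,\alpha_2$ with $\sigma(n)=\frac{\alpha_1}{\alpha_2}n$ and $2\le \omega(n)<\max(\alpha_1,\alpha_2)\le \tau(n)$. *)

(* Defs.v *)
From mathcomp Require Import all_boot all_order all_algebra.
Set Implicit Arguments.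
Unset Strict Implicit.
Unset Printing Implicit Defensive.

(* The functions below agree with the classical ones for n > 0 only:
   divisors 0 = primes 0 = [::]. *)
Definition sigma (n : nat) : nat := \sum_(d <- divisors n) d.

Definition omega (n : nat) : nat := size (primes n).

Definition tau (n : nat) : nat := size (divisors n).

Definition squarefree (n : nat) : Prop := forall d : nat, d ^ 2 %| n -> d = 1.

Definition abundancy_ratio (n a1 a2 : nat) : Prop :=
  [/\ 0 < a1, 0 < a2, coprime a1 a2 &
      ((sigma n)%:R = a1%:R / a2%:R * n%:R :> rat)%R].

Definition strong_alpha11 (n : nat) : Prop :=
  exists a1 a2 : nat,
    abundancy_ratio n a1 a2 /\ 2 <= maxn a1 a2 <= omega n.

Definition weak_alpha11 (n : nat) : Prop :=
  exists a1 a2 : nat,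
    abundancy_ratio n a1 a2 /\
    [/\ 2 <= omega n, omega n < maxn a1 a2 & maxn a1 a2 <= tau n].

(* Main.v *)
Require Import Defs.
From mathcomp Require Import all_boot all_order all_algebra.

(** If [n] is odd and squarefree with [k] prime divisors, then [tau n = 2 ^ k]
    divides [sigma n], the product of the [p + 1]. From [a2 sigma(n) = a1 n]
    with [n] odd, [2 ^ k] divides [a1], so [a1 <= tau n] forces [a1 = 2 ^ k].
    The equation then reads [a2 * \prod_p (p + 1) / 2 = n]; taking for [p] the
    least prime divisor of [n], the number [(p + 1) / 2] is a divisor of [n]
    strictly between [1] and [p], which is absurd. *)

(** A divisor of [p * m] prime to [p] divides [m] by Gauss; any other is [p] times a divisor of [m].
    The two kinds are disjoint since [p] does not divide [m]. Both [sigma] and [tau] are computed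
    from this splitting. *)
Lemma perm_divisors_prime_mul {p m : nat} : prime p -> coprime p m -> 0 < m ->
  perm_eq (divisors (p * m)) (divisors m ++ map (muln p) (divisors m)).
Proof.
move=> p_pr cpm m_gt0; have p_gt0 := prime_gt0 p_pr.
have pm_gt0 : 0 < p * m by rewrite muln_gt0 p_gt0.
have NpD d : p * d \notin divisors m.
  rewrite -dvdn_divisors //; apply/negP => /(dvdn_trans (dvdn_mulr d (dvdnn p))).
  by apply/negP; rewrite -prime_coprime.
apply: uniq_perm; first exact: divisors_uniq.
  rewrite cat_uniq divisors_uniq map_inj_uniq ?divisors_uniq ?andbT /=.
    by apply/hasPn => x /mapP[d _ ->].
  by move=> x y /eqP; rewrite eqn_pmul2l // => /eqP.
move=> d; rewrite mem_cat -!dvdn_divisors //.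
apply/idP/orP => [d_dv | [d_dv | /mapP[e]]]; last first.
- by rewrite -dvdn_divisors // => e_dv ->; rewrite dvdn_pmul2l.
- exact: dvdn_mull.
have [/dvdnP[e def_d] | pNd] := boolP (p %| d).
  right; apply/mapP; exists e; last by rewrite mulnC.
  by rewrite -dvdn_divisors // -(dvdn_pmul2l p_gt0) mulnC -def_d.
by left; rewrite -(@Gauss_dvdr _ p) // coprime_sym prime_coprime.
Qed.

Lemma sigma_prime_mul {p m : nat} : prime p -> coprime p m -> 0 < m ->
  sigma (p * m) = p.+1 * sigma m.
Proof.
move=> p_pr cpm m_gt0.
rewrite /sigma (perm_big _ (perm_divisors_prime_mul p_pr cpm m_gt0)) /=.
by rewrite big_cat big_map -big_distrr.
Qed.

Lemma tau_prime_mul {p m : nat} : prime p -> coprime p m -> 0 < m ->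
  tau (p * m) = 2 * tau m.
Proof.
move=> p_pr cpm m_gt0.
rewrite /tau (perm_size (perm_divisors_prime_mul p_pr cpm m_gt0)).
by rewrite size_cat size_map mul2n addnn.
Qed.

Lemma omega_prime_mul {p m : nat} : prime p -> coprime p m -> 0 < m ->
  omega (p * m) = (omega m).+1.
Proof.
move=> p_pr cpm m_gt0; have p_gt0 := prime_gt0 p_pr.
suff /perm_size : perm_eq (primes (p * m)) (p :: primes m) by [].
apply: uniq_perm; first exact: primes_uniq.
  by rewrite /= primes_uniq mem_primes p_pr m_gt0 -prime_coprime // cpm.
by move=> q; rewrite primesM // primes_prime // !inE.
Qed.

(** Induction step for squarefree numbers. The prime split off is the least one, which the final
    contradiction relies on. *)
Lemma squarefree_pdiv {n : nat} : 1 < n -> squarefree n ->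
  exists m, [/\ n = pdiv n * m, coprime (pdiv n) m, 0 < m, m < n & squarefree m].
Proof.
move=> n_gt1 n_sqf; have p_pr := pdiv_prime n_gt1.
have /dvdnP[m def_n] := pdiv_dvd n; set p := pdiv n in p_pr def_n *.
have m_gt0 : 0 < m by case: m def_n n_gt1 => [->|].
exists m; split=> //; first by rewrite mulnC.
- rewrite prime_coprime //; apply/negP => /dvdnP[e def_m].
  have /n_sqf p1 : p ^ 2 %| n by rewrite def_n def_m -mulnA mulnn dvdn_mull.
  by rewrite p1 in p_pr.
- by rewrite def_n ltn_Pmulr ?prime_gt1.
- by move=> d d_dv; apply: n_sqf; rewrite def_n dvdn_mulr.
Qed.

Lemma tau_squarefree {n : nat} : 0 < n -> squarefree n -> tau n = 2 ^ omega n.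
Proof.
elim/ltn_ind: n => n IHn n_gt0 n_sqf.
have [n_gt1 | n_le1] := ltnP 1 n; last first.
  by have -> : n = 1 by apply/eqP; rewrite eqn_leq n_le1.
have [m [def_n cpm m_gt0 m_lt m_sqf]] := squarefree_pdiv n_gt1 n_sqf.
have p_pr := pdiv_prime n_gt1.
by rewrite def_n tau_prime_mul // omega_prime_mul // IHn // expnS.
Qed.

(** Each prime [p] of [n] contributes a factor 2 to [tau n] and the even factor [p + 1] to
    [sigma n]. *)
Lemma tau_dvd_sigma {n : nat} : odd n -> squarefree n -> tau n %| sigma n.
Proof.
elim/ltn_ind: n => n IHn n_odd n_sqf.
have [n_gt1 | n_le1] := ltnP 1 n; last first.
  by have -> : n = 1 by apply/eqP; rewrite eqn_leq n_le1 odd_gt0.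
have [m [def_n cpm m_gt0 m_lt m_sqf]] := squarefree_pdiv n_gt1 n_sqf.
have p_pr := pdiv_prime n_gt1.
move: n_odd; rewrite def_n oddM => /andP[p_odd m_odd].
rewrite tau_prime_mul // sigma_prime_mul // dvdn_mul ?IHn //.
by rewrite dvdn2 /= p_odd.
Qed.

(** Clearing the denominator moves the problem from [rat] to divisibility in [nat]. *)
Lemma abundancy_ratioE {n a1 a2 : nat} : abundancy_ratio n a1 a2 ->
  sigma n * a2 = a1 * n.
Proof.
case=> _ a2_gt0 _ eq_s; apply/eqP; rewrite -(Num.Theory.eqr_nat rat).
by rewrite !GRing.natrM eq_s GRing.mulrAC GRing.divfK // Num.Theory.pnatr_eq0 -lt0n.
Qed.

Lemma tau_dvd_abundancy_num {n a1 a2 : nat} : odd n -> squarefree n ->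
  abundancy_ratio n a1 a2 -> tau n %| a1.
Proof.
move=> n_odd n_sqf /abundancy_ratioE eq_s; have n_gt0 := odd_gt0 n_odd.
(* The power of two [tau n] is coprime to the odd [n], so it suffices that it divides
   [a1 * n = sigma n * a2]. *)
rewrite -(@Gauss_dvdl _ _ n); first by rewrite -eq_s dvdn_mulr ?tau_dvd_sigma.
by rewrite tau_squarefree // coprimeXl // coprime2n.
Qed.

Lemma sigma_mul_neq_tau_mul {n a : nat} : 1 < n -> odd n -> squarefree n ->
  sigma n * a <> tau n * n.
Proof.
move=> n_gt1 n_odd n_sqf eq_s.
have [m [def_n cpm m_gt0 m_lt m_sqf]] := squarefree_pdiv n_gt1 n_sqf.
have p_pr := pdiv_prime n_gt1; set p := pdiv n in def_n cpm p_pr.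
have [p_odd m_odd] : odd p /\ odd m.
  by apply/andP; rewrite -oddM -def_n.
have /dvdnP[s def_s] := tau_dvd_sigma m_odd m_sqf.
have tau_gt0 : 0 < tau m by rewrite tau_squarefree // expn_gt0.
have p_gt2 : 2 < p by rewrite odd_prime_gt2.
have def_p : p.+1 = 2 * p.+1./2 by rewrite mul2n -[LHS]odd_double_half /= p_odd.
have h_dv : p.+1./2 %| n.
  have t_gt0 : 0 < 2 * tau m by rewrite muln_gt0.
  (* With [h = (p + 1) / 2], the equation becomes [2 * h * (s * tau m) * a = 2 * tau m * n];
     cancelling [2 * tau m] leaves [h * s * a = n]. *)
  move: eq_s; rewrite {1 2}def_n sigma_prime_mul // tau_prime_mul // def_s {1}def_p.
  move=> eq_s; rewrite -(dvdn_pmul2l t_gt0) -eq_s.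
  apply/dvdnP; exists (s * a).
  by rewrite [LHS](AC (2*2*1) (3*5*(1*4*2))).
have h_gt1 : 1 < p.+1./2 by rewrite -(ltn_pmul2l (isT : 0 < 2)) -def_p ltnW.
have := pdiv_min_dvd h_gt1 h_dv; rewrite -/p leqNgt => /negP[].
(* After doubling, [(p + 1) / 2 < p] reads [p + 1 < p + p]. *)
rewrite -(ltn_pmul2l (isT : 0 < 2)) -def_p mul2n -addnn -addn1 ltn_add2l.
exact: ltnW.
Qed.

Theorem theorem3p3 (n : nat) (n_gt0 : 0 < n) (n_odd : odd n)
    (n_sqf : squarefree n) :
  ~ (strong_alpha11 n \/ weak_alpha11 n).
Proof.
have tau_n := tau_squarefree n_gt0 n_sqf.
case=> -[a1 [a2 [ratio]]]; have tau_dv := tau_dvd_abundancy_num n_odd n_sqf ratio;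
  have a1_gt0 : 0 < a1 by case: ratio.
  (* Strong case: [2 ^ omega n = tau n <= a1 <= omega n], contradicting [k < 2 ^ k]. *)
  case/andP=> _ /(leq_trans (leq_maxl a1 a2)).
  move/(leq_trans (dvdn_leq a1_gt0 tau_dv)).
  by rewrite tau_n leqNgt ltn_expl.
case=> omega_ge2 _ /(leq_trans (leq_maxl a1 a2)) a1_le.
have def_a1 : a1 = tau n by apply/eqP; rewrite eqn_leq a1_le dvdn_leq.
(* The bound [2 <= omega n] rules out [n = 1], for which [sigma 1 * 1 = tau 1 * 1] does hold. *)
have n_gt1 : 1 < n by move: omega_ge2; clear; case: n => [|[]].
apply: (@sigma_mul_neq_tau_mul n a2 n_gt1) => //.
by rewrite (abundancy_ratioE ratio) def_a1.
Qed.
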